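(* Suppose that $U_P(x)=-e^{-\gamma_P x}$ and $U_A(x)=-e^{-\gamma_A x}$ with $\gamma_P>0$ and $\gamma_A>0$. Then there exists a solution to the problem $\sup_{(W,a)\in C_m}\mathbb{E}[U_P(X^a-W)]$, i.e. the supremum is attained at some element of $C_m$.
   Context: Let $\Omega$ be an uncountable sample space, $(\Omega,\mathbb{F},\mathbb{P})$ a probability space, $L^2(\Omega)$ the square-integrable real random variables, and $B\in L^2(\Omega)$. Fix $x_0\in\mathbb{R}$, $K>0$; set $X^a=x_0+a+B$ and $\kappa(a)=K a^2/2$ for $a\in\mathbb{R}$. $E=L^2(\Omega)\times\mathbb{R}$. Fix $0\le m\le y$. Assume $\mathbb{E}[|U_P(X^0-y)|]<\infty$. Expectations of utilities are understood in $[-\infty,\infty)$. Define $C_m=\{(W,a)\in E: m\le W\ \mathbb{P}\text{-a.s.},\ \mathbb{E}[U_A(W-\kappa(a))]\ge U_A(y)\}$. *)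

(* Defs.v *)
From HB Require Import structures.
From mathcomp Require Import all_boot all_order all_algebra.
From mathcomp Require Import all_classical all_reals all_analysis.
Import Order.TTheory GRing.Theory Num.Theory.
Import numFieldNormedType.Exports.

Set Implicit Arguments.
Unset Strict Implicit.
Unset Printing Implicit Defensive.

Local Open Scope classical_set_scope.
Local Open Scope ring_scope.

(* The outcome X^a = x0 + a + B of the project under effort a. *)
Definition outcome {T : Type} {R : realType} (x0 : R) (B : T -> R) (a : R) :
  T -> R := fun w => x0 + a + B w.

Definition effort_cost {R : realType} (K a : R) : R := K * a ^+ 2 / 2.

(* Elements of L^2 are represented by square-integrable random variables
   rather than by their classes modulo almost sure equality; every notion
   below only depends on the class.  Expectations are extended-real valued. *)
Definition admissible {d : measure_display} {T : measurableType d}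
    {R : realType} (P : probability T R) (K : R) (UA : R -> R) (m y : R) :
    set ((T -> R) * R) :=
  [set c | c.1 \in Lfun P 2%:E /\
           {ae P, forall w, m <= c.1 w} /\
           ((UA y)%:E <= 'E_P[fun w => UA (c.1 w - effort_cost K c.2)%R])%E].

(* Expected utility of the principal, E[U_P(X^a - W)], for c = (W, a). *)
Definition principal_value {d : measure_display} {T : measurableType d}
    {R : realType} (P : probability T R) (x0 : R) (B : T -> R) (UP : R -> R)
    (c : (T -> R) * R) : \bar R :=
  ('E_P[fun w => UP (outcome x0 B c.2 w - c.1 w)%R])%E.

(* Main.v *)
Require Import Defs.
From HB Require Import structures.
From mathcomp Require Import all_boot all_order all_algebra.
From mathcomp Require Import all_classical all_reals all_analysis.
From mathcomp Require Import measurable_realfun ring lra.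
Import Order.TTheory GRing.Theory Num.Theory.
Import numFieldNormedType.Exports.

(** Write p and q for the risk aversions of the principal and of the agent.
The problem is to minimise exp(-p(x0+a)) E[exp(-p(B-W))] over wages W >= m and
efforts a such that E[exp(-q W)] <= exp(-q(y + K a^2/2)).

For a fixed effort this is a convex problem, whose Lagrangian can be minimised
pointwise in the outcome.  Its minimisers form the one-parameter family of
Borch sharing rules with floor m,
  W_s = max(m, ln s + r B),  r = p/(p+q),
with multiplier proportional to s^(p+q), where s = 0 stands for the constant
wage m.  By wage_optimal, W_s minimises E[exp(-p(B-W))] among the wages above m
that leave the agent at most the disutility G(s) = E[exp(-q W_s)].  Since G is
continuous, nonincreasing and tends to 0, every feasible participation level is
attained by some s (agent_IVT), and so only pairs (W_s, a) with a binding
participation constraint matter.  The constraint then determines |a| from s,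
and the sign a >= 0 is the better one, so that the problem is the minimisation
of a continuous function of s on a half-line (exists_best_wage).

Compactness comes from Jensen's inequality: it bounds the principal's
disutility below by exp(p(mu - a - E[B])) with mu = E[W_s], and the
participation constraint forces K a^2/2 <= mu - y.  As
a <= K a^2/4 + 1/K, the disutility is at least of order exp(p mu / 2), which
tends to infinity with s (contract_disutility_coercive).

The wages W_s are square integrable because B is.  All exponential moments that
occur along the family are controlled by E[exp(-p B)], which is finite by the
integrability of U_P(X^0 - y). *)

Set Implicit Arguments.
Unset Strict Implicit.

Local Open Scope classical_set_scope.
Local Open Scope ring_scope.

(** * Convexity inequalities for the exponential *)

Section exp_inequalities.
Context {R : realType}.
Implicit Types x y t : R.

Lemma expR_tangent x y : expR y * (1 + (x - y)) <= expR x.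
Proof.
have -> : expR x = expR y * expR (x - y) by rewrite -expRD addrC subrK.
by rewrite ler_pM2l ?expR_gt0// expR_ge1Dx.
Qed.

(** Bounds the fractional powers Z^t of Z = exp(x) by 1 + Z, so that
integrability of Z gives that of Z^t. *)
Lemma expR_interpolate t x : 0 <= t -> t <= 1 -> expR (t * x) <= 1 + expR x.
Proof.
move=> t0 t1; have [x0|x0] := leP x 0.
  have : expR (t * x) <= 1 by rewrite expR_le1 mulr_ge0_le0.
  by have := expR_ge0 x; lra.
have : expR (t * x) <= expR x by rewrite ler_expR ler_piMl// ltW.
lra.
Qed.

End exp_inequalities.

(** * The Borch sharing rule with a floor *)

Section wage.
Context {R : realType}.
Variables (p q m : R).
Hypotheses (p0 : 0 < p) (q0 : 0 < q).
Implicit Types s b u : R.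

Definition wage_share : R := p / (p + q).

(** For s > 0 this is max(m, ln s + r b); writing the maximum under the
logarithm makes the family continuous down to s = 0, where it is the constant
m. *)
Definition wage s b : R := ln (Num.max (expR m) (s * expR (wage_share * b))).

Let pq0 : p + q != 0. Proof. by rewrite gt_eqF// addr_gt0. Qed.

Lemma wage_share01 : 0 <= wage_share <= 1.
Proof.
have pq : 0 < p + q by rewrite addr_gt0.
by rewrite /wage_share divr_ge0 ?(ltW pq) ?(ltW p0)//= ler_pdivrMr// mul1r lerDl ltW.
Qed.

(** Under the sharing rule both parties bear the same exponential risk: the
agent's exponent -q r B is the principal's -p (1 - r) B. *)
Lemma wage_shareC : q * wage_share = p * (1 - wage_share).
Proof. rewrite /wage_share; field; exact: pq0. Qed.

Lemma wage_arg_gt0 s b : 0 < Num.max (expR m) (s * expR (wage_share * b)).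
Proof. by rewrite lt_max expR_gt0. Qed.

Lemma wage_le0 s b : s <= 0 -> wage s b = m.
Proof.
move=> s0; rewrite /wage max_l ?expRK//.
by rewrite (@le_trans _ _ 0) ?expR_ge0// mulr_le0_ge0 ?expR_ge0.
Qed.

Lemma wage_gt0 s b : 0 < s -> wage s b = Num.max m (ln s + wage_share * b).
Proof.
move=> s0; rewrite /wage -[s in s * _](@lnK _ s) ?posrE// -expRD.
have [h|/ltW h] := leP m (ln s + wage_share * b).
  by rewrite max_r ?expRK// ler_expR.
by rewrite max_l ?expRK// ler_expR.
Qed.

Lemma wage_ge s b : m <= wage s b.
Proof.
have [s0|s0] := leP s 0; first by rewrite wage_le0.
by rewrite wage_gt0// le_max lexx.
Qed.

Lemma wage_homo b : {homo wage^~ b : s s' / s <= s'}.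
Proof.
move=> s s' ss'; rewrite /wage ler_ln ?posrE ?wage_arg_gt0//.
by rewrite ge_max le_max lexx/= le_max ler_wpM2r ?orbT// expR_ge0.
Qed.

Lemma wage_continuous b : continuous (wage^~ b).
Proof.
move=> s; apply: (@continuous_comp _ _ _
    (fun s => Num.max (expR m) (s * expR (wage_share * b))) (@ln R)); last first.
  by apply: continuous_ln; exact: wage_arg_gt0.
apply: (@continuous_max _ _ (fun _ => expR m)
  (fun s => s * expR (wage_share * b))).
  exact: cvg_cst.
by apply: cvgMl; exact: cvg_id.
Qed.

Lemma wage_measurable s : measurable_fun [set: R] (wage s).
Proof.
apply: measurableT_comp => //.
apply: measurable_maxr => //; apply: measurable_funM => //.
by apply: measurableT_comp => //; apply: measurable_funM.
Qed.

(** The multiplier for which the first-order condition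
p exp(-p(b-v)) = l q exp(-q v) of the Lagrangian is solved by
v = ln s + r b for all b. *)
Definition wage_multiplier s : R :=
  if s <= 0 then 0 else p / q * expR ((p + q) * ln s).

Lemma wage_multiplier_ge0 s : 0 <= wage_multiplier s.
Proof.
rewrite /wage_multiplier; case: ifP => // _.
by rewrite mulr_ge0 ?expR_ge0// divr_ge0 ?(ltW p0) ?(ltW q0).
Qed.

(** The Lagrangian is convex in u, so it suffices that its derivative D at
v = wage s b satisfies 0 <= (u - v) D.  Either v solves the first-order
condition and D = 0, or v is the floor m, in which case u >= v and D >= 0. *)
Lemma wage_lagrangian s b u : m <= u ->
  expR (- p * (b - wage s b)) + wage_multiplier s * expR (- q * wage s b) <=
  expR (- p * (b - u)) + wage_multiplier s * expR (- q * u).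
Proof.
move=> mu; have [s0|s0] := leP s 0.
  rewrite /wage_multiplier s0 !mul0r !addr0 ler_expR wage_le0//.
  by rewrite !mulNr lerN2 ler_pM2l// lerB.
(* Convexity: both exponentials lie above their tangents at v. *)
have T1 := expR_tangent (- p * (b - u)) (- p * (b - wage s b)).
have T2 := expR_tangent (- q * u) (- q * wage s b).
have L0 := wage_multiplier_ge0 s.
have {}T2 := ler_wpM2l L0 T2.
set v := wage s b in T1 T2 *.
suff : 0 <= (u - v) * (p * expR (- p * (b - v)) -
                       wage_multiplier s * q * expR (- q * v)).
  by move: T1 T2; set E1 := expR (- p * (b - v)); set E2 := expR (- q * v); nra.
have -> : wage_multiplier s * q * expR (- q * v) =
    p * expR ((p + q) * ln s - q * v).
  rewrite /wage_multiplier leNgt s0/= expRD mulNr.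
  by field; rewrite gt_eqF.
rewrite -mulrBr mulrCA mulr_ge0 ?(ltW p0)//.
have key : (p + q) * (ln s + wage_share * b) = (p + q) * ln s + p * b.
  by rewrite /wage_share; field; exact: pq0.
have vE : v = Num.max m (ln s + wage_share * b) by rewrite /v wage_gt0.
have [h|h] := leP m (ln s + wage_share * b).
  rewrite max_r// in vE.
  suff -> : (p + q) * ln s - q * v = - p * (b - v) by rewrite subrr mulr0.
  have := key; rewrite -vE; nra.
rewrite max_l ?(ltW h)// in vE.
rewrite mulr_ge0 ?subr_ge0 ?vE// ler_expR.
have : (p + q) * (ln s + wage_share * b) <= (p + q) * m.
  by rewrite ler_pM2l ?addr_gt0// ltW.
rewrite key; nra.
Qed.

End wage.

(** * Integration against a probability *)

Section integrals.
Context {R : realType} {d : measure_display} {T : measurableType d}.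
Variable P : probability T R.

Lemma integrable_cst_prob (c : R) : P.-integrable setT (EFin \o cst c).
Proof. by apply: finite_measure_integrable_cst. Qed.

Lemma Rintegral_cst_prob (c : R) : \int[P]_w c = c.
Proof.
rewrite (Rintegral_cst P)//.
by have -> : fine (P setT) = 1; [rewrite probability_setT | rewrite mulr1].
Qed.

Lemma integrable_nng_dominated (f g : T -> R) :
  measurable_fun setT f -> (forall w, 0 <= f w <= g w) ->
  P.-integrable setT (EFin \o g) -> P.-integrable setT (EFin \o f).
Proof.
move=> mf fg; apply: le_integrable => //; first exact/measurable_EFinP.
move=> w _ /=; have /andP[f0 fgw] := fg w.
by rewrite lee_fin !ger0_norm// (le_trans f0).
Qed.

Lemma sqr_integrable_Lfun2 (f : T -> R) : measurable_fun setT f ->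
  P.-integrable setT (EFin \o (fun w => f w ^+ 2)) -> f \in Lfun P 2%:E.
Proof.
move=> mf /integrableP[_ foo].
rewrite inE; apply/andP; split; rewrite inE//=.
rewrite /finite_norm unlock; apply: poweR_lty.
rewrite (le_lt_trans _ foo)// le_eqVlt; apply/orP; left; apply/eqP.
apply: eq_integral => w _ /=.
by rewrite powR_mulrn// normrX.
Qed.

(** Integrate the tangent of the exponential at the mean of X. *)
Lemma expR_Jensen (X : T -> R) : P.-integrable setT (EFin \o X) ->
  P.-integrable setT (EFin \o (fun w => expR (X w))) ->
  expR (\int[P]_w X w) <= \int[P]_w expR (X w).
Proof.
move=> iX ieX; set mu := \int[P]_w X w.
have i1 : P.-integrable setT (EFin \o (fun w => 1 + (X w - mu))).
  have -> : EFin \o (fun w => 1 + (X w - mu)) =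
      (EFin \o cst (1 - mu)) \+ (EFin \o X).
    by apply/funext => w /=; rewrite -EFinD; congr EFin; ring.
  by apply: integrableD => //; exact: integrable_cst_prob.
have -> : expR mu = \int[P]_w (expR mu * (1 + (X w - mu))).
  rewrite RintegralZl// (_ : \int[P]_w (1 + (X w - mu)) = 1) ?mulr1//.
  under eq_Rintegral do rewrite addrCA.
  rewrite RintegralD//; last exact: integrable_cst_prob.
  by rewrite -/mu Rintegral_cst_prob; ring.
apply: le_Rintegral => //; last by move=> w _; exact: expR_tangent.
by have := @integrableZl _ _ _ P _ measurableT (expR mu) _ i1.
Qed.

End integrals.

(** * Disutilities along the family of sharing rules *)

Section borch_wages.
Context {R : realType} {d : measure_display} {T : measurableType d}.
Variables (P : probability T R) (B : T -> R) (p q m : R).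
Hypotheses (p0 : 0 < p) (q0 : 0 < q).
Hypothesis B2 : B \in Lfun P 2%:E.
Hypothesis iZ : P.-integrable setT (EFin \o (fun w => expR (- p * B w))).

Let W s w := wage p q m s (B w).

Let mB : measurable_fun setT B.
Proof. by move: B2; rewrite inE => /andP[]; rewrite inE. Qed.

Let iB : P.-integrable setT (EFin \o B).
Proof.
apply/Lfun1_integrable; apply: Lfun_subset12 B2.
by rewrite fin_num_measure.
Qed.

Let mW s : measurable_fun setT (W s).
Proof. by apply: measurableT_comp => //; exact: wage_measurable. Qed.

(** The square of a maximum is at most the sum of the squares. *)
Lemma wage_Lfun2 s : W s \in Lfun P 2%:E.
Proof.
apply: sqr_integrable_Lfun2 => //.
have [s0|s0] := leP s 0.
  have -> : (fun w => W s w ^+ 2) = cst (m ^+ 2).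
    by apply/funext => w; rewrite /W wage_le0.
  exact: integrable_cst_prob.
pose X w := ln s + wage_share p q * B w.
have iX : P.-integrable setT (EFin \o (fun w => X w ^+ 2)).
  apply: Lfun2_integrable_sqr.
  have -> : X = cst (ln s) + (wage_share p q \o* B).
    by apply/funext => w; rewrite /X mulrC.
  apply: (Lfun_addr_closed _ _).2; rewrite ?lee1n//.
    exact: Lfun_cst.
  by apply: Lfun_scale => //; rewrite ler1n.
apply: (integrable_nng_dominated (g := fun w => m ^+ 2 + X w ^+ 2)).
- exact: measurable_funX.
- move=> w; rewrite sqr_ge0/= /W wage_gt0// -/(X w).
  have := sqr_ge0 m; have := sqr_ge0 (X w).
  by case: (leP m (X w)) => h; rewrite ?(max_r h) ?(max_l (ltW h)); lra.
- exact: (integrableD measurableT (integrable_cst_prob P (m ^+ 2)) iX).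
Qed.

Let iW s : P.-integrable setT (EFin \o W s).
Proof.
apply/Lfun1_integrable; apply: Lfun_subset12 (wage_Lfun2 s).
by rewrite fin_num_measure.
Qed.

Definition agent_disutility s : R := \int[P]_w expR (- q * wage p q m s (B w)).

Definition principal_disutility s : R :=
  \int[P]_w expR (- p * (B w - wage p q m s (B w))).

Local Notation G := agent_disutility.
Local Notation H := principal_disutility.

Let mexpR (c : R) (f : T -> R) : measurable_fun setT f ->
  measurable_fun setT (fun w => expR (c * f w)).
Proof. by move=> mf; apply: measurableT_comp => //; exact: measurable_funM. Qed.

Let agent_bound s w : expR (- q * W s w) <= expR (- q * m).
Proof. by rewrite ler_expR !mulNr lerN2 ler_pM2l// wage_ge. Qed.

Lemma agent_integrable s :
  P.-integrable setT (EFin \o (fun w => expR (- q * W s w))).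
Proof.
apply: integrable_nng_dominated (integrable_cst_prob P (expR (- q * m))).
  exact: mexpR.
by move=> w; rewrite expR_ge0 agent_bound.
Qed.

Let tiltE w :
  - p * (1 - wage_share p q) * B w = (1 - wage_share p q) * (- p * B w).
Proof. by ring. Qed.

Let tilt_bound w :
  expR (- p * (1 - wage_share p q) * B w) <= 1 + expR (- p * B w).
Proof.
have /andP[r0 r1] := wage_share01 p0 q0.
by rewrite tiltE expR_interpolate//; lra.
Qed.

(** Dominates the principal's integrand exp(-p(B - W_s)) for all s <= S: at
s = S, where it is largest, it is the larger of exp(p m) Z and S^p Z^(1-r), with
Z = exp(-p B). *)
Let dom S w := expR (p * m) * expR (- p * B w) +
  expR (p * ln S) * (1 + expR (- p * B w)).

Let dom_integrable S : P.-integrable setT (EFin \o dom S).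
Proof.
have i1 : P.-integrable setT (EFin \o (fun w => 1 + expR (- p * B w))).
  exact: (integrableD measurableT (integrable_cst_prob P 1) iZ).
exact: (integrableD measurableT (integrableZl measurableT (expR (p * m)) iZ)
  (integrableZl measurableT (expR (p * ln S)) i1)).
Qed.

Let principal_bound S s w : 0 < S -> s <= S ->
  expR (- p * (B w - W s w)) <= dom S w.
Proof.
move=> S0 sS; apply: (@le_trans _ _ (expR (- p * (B w - W S w)))).
  rewrite ler_expR !mulNr lerN2 ler_pM2l// lerB//.
  exact: wage_homo.
have Z0 := expR_ge0 (- p * B w); rewrite /dom.
have E0 := expR_ge0 (p * ln S); have Em := expR_ge0 (p * m).
rewrite /W wage_gt0//.
have [h|/ltW h] := leP m (ln S + wage_share p q * B w);
  rewrite ?(max_r h) ?(max_l h).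
  have -> : - p * (B w - (ln S + wage_share p q * B w)) =
    p * ln S + - p * (1 - wage_share p q) * B w by ring.
  rewrite expRD; have := ler_wpM2l E0 (tilt_bound w).
  have := mulr_ge0 Em Z0; lra.
have -> : - p * (B w - m) = p * m + - p * B w by ring.
rewrite expRD; have := mulr_ge0 E0 Z0; lra.
Qed.

Lemma principal_integrable s :
  P.-integrable setT (EFin \o (fun w => expR (- p * (B w - W s w)))).
Proof.
have S0 : 0 < Num.max s 1 by rewrite lt_max ltr01 orbT.
apply: integrable_nng_dominated (dom_integrable (Num.max s 1)).
  by apply: mexpR; exact: measurable_funB.
by move=> w; rewrite expR_ge0 principal_bound// le_max lexx.
Qed.

Lemma agent_disutilityE s :
  (\int[P]_w (expR (- q * W s w))%:E = (G s)%:E)%E.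
Proof.
rewrite /G /Rintegral fineK//.
by apply: integrable_fin_num => //; exact: agent_integrable.
Qed.

Lemma principal_disutilityE s :
  (\int[P]_w (expR (- p * (B w - W s w)))%:E = (H s)%:E)%E.
Proof.
rewrite /H /Rintegral fineK//.
by apply: integrable_fin_num => //; exact: principal_integrable.
Qed.

Lemma agent_continuous : continuous G.
Proof.
move=> x; apply: (@continuity_under_integral _ _ _ P
  (fun s w => expR (- q * W s w)) setT measurableT (x - 1) (x + 1) _ _
  (cst (expR (- q * m)))).
- by move=> s _; exact: agent_integrable.
- apply: aeW => w _ s _; apply: continuous_comp; last exact: continuous_expR.
  by apply: cvgMr; exact: wage_continuous.
- exact: integrable_cst_prob.
- by move=> s _; apply: aeW => w _; rewrite ger0_norm ?expR_ge0// agent_bound.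
- by rewrite inE/= in_itv/=; lra.
Qed.

Lemma principal_continuous : continuous H.
Proof.
move=> x; pose S := `|x| + 1.
have S0 : 0 < S by rewrite ltr_wpDl.
apply: (@continuity_under_integral _ _ _ P
  (fun s w => expR (- p * (B w - W s w))) setT measurableT (x - 1) (x + 1) _ _
  (dom S)).
- by move=> s _; exact: principal_integrable.
- apply: aeW => w _ s _; apply: continuous_comp; last exact: continuous_expR.
  apply: cvgMr; apply: cvgB; first exact: cvg_cst.
  exact: wage_continuous.
- exact: dom_integrable.
- move=> s /=; rewrite in_itv/= => /andP[_ sx]; apply: aeW => w _.
  rewrite ger0_norm ?expR_ge0// principal_bound//.
  by rewrite /S (le_trans (ltW sx))// lerD2r ler_norm.
- by rewrite inE/= in_itv/=; lra.
Qed.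

Lemma agent_antitone s s' : s <= s' -> G s' <= G s.
Proof.
move=> ss'; apply: le_Rintegral => //; [exact: agent_integrable..|].
by move=> w _; rewrite ler_expR !mulNr lerN2 ler_pM2l// wage_homo.
Qed.

Lemma agent_ge_mean s : expR (- q * \int[P]_w W s w) <= G s.
Proof.
rewrite -RintegralZl//; apply: expR_Jensen; last exact: agent_integrable.
exact: (integrableZl measurableT (- q) (iW s)).
Qed.

Lemma agent_gt0 s : 0 < G s.
Proof. by rewrite (lt_le_trans _ (agent_ge_mean s))// expR_gt0. Qed.

Lemma principal_ge_mean s :
  expR (- p * (\int[P]_w B w - \int[P]_w W s w)) <= H s.
Proof.
rewrite -RintegralB// -RintegralZl//;
  last exact: (integrableB measurableT iB (iW s)).
apply: expR_Jensen; last exact: principal_integrable.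
exact: (integrableZl measurableT (- p) (integrableB measurableT iB (iW s))).
Qed.

Lemma wage_mean_ge s : 0 < s ->
  ln s + wage_share p q * \int[P]_w B w <= \int[P]_w W s w.
Proof.
move=> s0.
have iX : P.-integrable setT (EFin \o (fun w => ln s + wage_share p q * B w)).
  exact: (integrableD measurableT (integrable_cst_prob P (ln s))
    (integrableZl measurableT (wage_share p q) iB)).
rewrite -RintegralZl// -[in leLHS](Rintegral_cst_prob P (ln s)) -RintegralD//.
- by apply: le_Rintegral => // w _; rewrite /W wage_gt0// le_max lexx orbT.
- exact: integrable_cst_prob.
- exact: (integrableZl measurableT (wage_share p q) iB).
Qed.

(** The agent's disutility decays like s^(-q), because
exp(-q W_s) <= s^(-q) Z^(1-r) with Z = exp(-p B). *)
Lemma agent_tail s : 0 < s ->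
  G s <= expR (- q * ln s) * \int[P]_w (1 + expR (- p * B w)).
Proof.
have i1 : P.-integrable setT (EFin \o (fun w => 1 + expR (- p * B w))).
  exact: (integrableD measurableT (integrable_cst_prob P 1) iZ).
move=> s0; rewrite -RintegralZl//; apply: le_Rintegral => //.
- exact: agent_integrable.
- exact: (integrableZl measurableT (expR (- q * ln s)) i1).
move=> w _; apply: le_trans (ler_wpM2l (expR_ge0 _) (tilt_bound w)).
rewrite -expRD ler_expR.
have -> : - q * ln s + - p * (1 - wage_share p q) * B w =
    - q * (ln s + wage_share p q * B w).
  transitivity (- q * ln s - q * wage_share p q * B w); last by ring.
  by rewrite (wage_shareC p0 q0); ring.
by rewrite !mulNr lerN2 ler_pM2l// wage_gt0// le_max lexx orbT.
Qed.

(** The intermediate value theorem between s0 and a point at which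
agent_tail brings the disutility below v. *)
Lemma agent_IVT s0 v : 0 < v -> v <= G s0 -> exists2 s, s0 <= s & G s = v.
Proof.
move=> v0 vG; set M := \int[P]_w (1 + expR (- p * B w)).
(* The second bound solves exp(-q ln b) M = v. *)
pose b := Num.max s0 (expR (ln (M / v) / q)).
have b0 : 0 < b by rewrite lt_max expR_gt0 orbT.
have s0b : s0 <= b by rewrite le_max lexx.
have M0 : 0 < M.
  have := lt_le_trans (agent_gt0 1) (agent_tail ltr01).
  by rewrite ln1 mulr0 expR0 mul1r.
have Gb : G b <= v.
  apply: (le_trans (agent_tail b0)); rewrite -/M.
  rewrite -ler_pdivlMr//.
  have -> : v / M = expR (- ln (M / v)).
    by rewrite expRN lnK ?posrE ?divr_gt0// invf_div.
  rewrite ler_expR mulNr lerN2 [q * _]mulrC -ler_pdivrMr//.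
  have : ln (expR (ln (M / v) / q)) <= ln b.
    by rewrite ler_ln ?posrE ?expR_gt0// le_max lexx orbT.
  by rewrite expRK.
have [s sab Gs] : exists2 s, s \in `[s0, b] & G s = v.
  apply: IVT => //; first exact/continuous_subspaceT/agent_continuous.
  by rewrite ge_min Gb orbT/= le_max vG.
by exists s => //; move: sab; rewrite in_itv/= => /andP[].
Qed.

(** Weak duality: integrating the pointwise minimality of the Lagrangian gives
H(s) + l G(s) <= E[exp(-p(B-V))] + l E[exp(-q V)], and the constraint bounds the
last expectation by G(s), which is finite and cancels.  The integrals are
extended-real valued as exp(-p(B-V)) need not be integrable. *)
Lemma wage_optimal s (V : T -> R) : measurable_fun setT V ->
  {ae P, forall w, m <= V w} ->
  (\int[P]_w (expR (- q * V w))%:E <= (G s)%:E)%E ->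
  ((H s)%:E <= \int[P]_w (expR (- p * (B w - V w)))%:E)%E.
Proof.
move=> mV mleV.
set J := (X in (X <= _)%E); set I := (X in (_ -> _ <= X)%E) => JG.
pose l := wage_multiplier p q s.
have l0 : 0 <= l by exact: wage_multiplier_ge0.
have lagrE (U : T -> R) : measurable_fun setT U ->
    (\int[P]_w (expR (- p * (B w - U w)) + l * expR (- q * U w))%:E =
     \int[P]_w (expR (- p * (B w - U w)))%:E +
     l%:E * \int[P]_w (expR (- q * U w))%:E)%E.
  move=> mU; have meU : measurable_fun setT (fun w => (expR (- q * U w))%:E).
    by apply/measurable_EFinP; exact: mexpR.
  rewrite -(ge0_integralZl_EFin P measurableT _ meU l0); last first.
    by move=> w _; rewrite lee_fin expR_ge0.
  rewrite -ge0_integralD//.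
  - by apply/measurable_EFinP; apply: mexpR; exact: measurable_funB.
  - by move=> w _; rewrite -EFinM lee_fin mulr_ge0 ?expR_ge0.
  - exact: measurable_funeM.
have mL (U : T -> R) : measurable_fun setT U -> measurable_fun setT
    (fun w => (expR (- p * (B w - U w)) + l * expR (- q * U w))%:E).
  move=> mU; apply/measurable_EFinP; apply: measurable_funD.
    by apply: mexpR; exact: measurable_funB.
  by apply: measurable_funM => //; exact: mexpR.
have L0 (U : T -> R) w :
  (0 <= (expR (- p * (B w - U w)) + l * expR (- q * U w))%:E)%E.
  by rewrite lee_fin addr_ge0// ?mulr_ge0 ?expR_ge0.
have le1 : ((H s)%:E + l%:E * (G s)%:E <= I + l%:E * J)%E.
  rewrite -agent_disutilityE -principal_disutilityE -!lagrE//.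
  apply: ae_ge0_le_integral => //; [exact: mL..|].
  by apply: filterS mleV => w mVw _; rewrite lee_fin wage_lagrangian.
have le2 : (I + l%:E * J <= I + l%:E * (G s)%:E)%E.
  by rewrite leeD2l// lee_wpmul2l// lee_fin.
by have := le_trans le1 le2; rewrite -EFinM leeD2rE.
Qed.

(** * The effort made under a binding participation constraint *)

Variables (K y : R).
Hypothesis K0 : 0 < K.

(** The nonnegative solution a of G(s) = exp(-q (y + K a^2/2)), which exists
when G(s) <= exp(-q y). *)
Definition effort s : R := Num.sqrt (2 / K * (- ln (G s) / q - y)).

(** The principal's disutility up to the constant factor exp(-p x0). *)
Definition contract_disutility s : R := expR (- p * effort s) * H s.

Let reserve_ge0 s : G s <= expR (- q * y) -> 0 <= - ln (G s) / q - y.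
Proof.
move=> Gy; rewrite subr_ge0 ler_pdivlMr// lerNr.
have -> : - (y * q) = ln (expR (- q * y)) by rewrite expRK; ring.
by rewrite ler_ln ?posrE ?expR_gt0 ?agent_gt0.
Qed.

Lemma effort_costE s : G s <= expR (- q * y) ->
  effort_cost K (effort s) = - ln (G s) / q - y.
Proof.
move=> Gy; rewrite /effort_cost /effort sqr_sqrtr.
  by field; rewrite ?gt_eqF.
by rewrite mulr_ge0 ?reserve_ge0 ?divr_ge0 ?(ltW K0).
Qed.

Lemma effort_binding s a : G s = expR (- q * (y + effort_cost K a)) ->
  effort s = `|a|.
Proof.
move=> Gs; rewrite /effort Gs expRK -sqrtr_sqr; congr Num.sqrt.
by rewrite /effort_cost; field; rewrite ?gt_eqF.
Qed.

Lemma agent_binding s : G s <= expR (- q * y) ->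
  G s = expR (- q * (y + effort_cost K (effort s))).
Proof.
move=> Gy; rewrite effort_costE//.
have -> : - q * (y + (- ln (G s) / q - y)) = ln (G s) by field; rewrite gt_eqF.
by rewrite lnK ?posrE ?agent_gt0.
Qed.

Lemma contract_disutility_gt0 s : 0 < contract_disutility s.
Proof.
rewrite mulr_gt0 ?expR_gt0// (lt_le_trans _ (principal_ge_mean s))//.
exact: expR_gt0.
Qed.

Lemma contract_disutility_continuous : continuous contract_disutility.
Proof.
move=> s; apply: cvgM; last exact: principal_continuous.
apply: (@continuous_comp _ _ _ (fun s => - p * effort s) (@expR R));
  last exact: continuous_expR.
apply: cvgMr.
apply: (@continuous_comp _ _ _ (fun s => 2 / K * (- ln (G s) / q - y))
  (@Num.sqrt R)); last exact: sqrt_continuous.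
apply: cvgMr; apply: cvgB; last exact: cvg_cst.
apply: cvgMl; apply: cvgN.
apply: (@continuous_comp _ _ _ G (@ln R)); first exact: agent_continuous.
by apply: continuous_ln; exact: agent_gt0.
Qed.

(** With mu = E[W_s] and a = effort s, Jensen's inequality for the principal
gives the lower bound exp(p(mu - a - E[B])), and for the agent
K a^2/2 <= mu - y; hence a <= K a^2/4 + 1/K <= (mu - y)/2 + 1/K. *)
Lemma contract_disutility_coercive s : 0 < s -> G s <= expR (- q * y) ->
  expR (p * ((ln s + wage_share p q * \int[P]_w B w) / 2 + y / 2 - K^-1
             - \int[P]_w B w)) <= contract_disutility s.
Proof.
move=> s0 Gy; have mu_ge := wage_mean_ge s0.
set EB := \int[P]_w B w in mu_ge *; set mu := (X in _ <= X) in mu_ge.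
have H_ge : expR (- p * (EB - mu)) <= H s by exact: principal_ge_mean.
have G_ge : expR (- q * mu) <= G s by exact: agent_ge_mean.
apply: le_trans (ler_wpM2l (expR_ge0 _) H_ge).
rewrite -expRD ler_expR.
have -> : - p * effort s + - p * (EB - mu) = p * (mu - effort s - EB) by ring.
rewrite ler_pM2l//.
have lnG : - ln (G s) / q <= mu.
  rewrite ler_pdivrMr// lerNl.
  have -> : - (mu * q) = ln (expR (- q * mu)) by rewrite expRK; ring.
  by rewrite ler_ln ?posrE ?expR_gt0 ?agent_gt0.
have amgm : effort s <= effort_cost K (effort s) / 2 + K^-1.
  rewrite -subr_ge0; set a := effort s.
  have -> : effort_cost K a / 2 + K^-1 - a = (K * a / 2 - 1) ^+ 2 / K.
    by rewrite /effort_cost; field; rewrite gt_eqF.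
  by rewrite divr_ge0 ?sqr_ge0// ltW.
rewrite effort_costE// in amgm; lra.
Qed.

Hypothesis m_le_y : m <= y.

(** The starting point s0, at which effort vanishes, exists because the
constant wage m <= y, which is s = 0, gives the agent at most the utility of y.
Coercivity confines the minimisation over s >= s0 to a segment. *)
Lemma exists_best_wage : exists s0 s1, [/\ s0 <= s1, G s0 = expR (- q * y) &
  forall s, s0 <= s -> contract_disutility s1 <= contract_disutility s].
Proof.
have [s0 s00 Gs0] : exists2 s0, 0 <= s0 & G s0 = expR (- q * y).
  apply: agent_IVT; first exact: expR_gt0.
  rewrite /G; under eq_Rintegral do rewrite wage_le0//.
  by rewrite Rintegral_cst_prob ler_expR !mulNr lerN2 ler_pM2l.
pose f := contract_disutility.
(* Beyond exp(L), the coercive lower bound exceeds the value at s0. *)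
pose L := 2 * (ln (f s0) / p - y / 2 + K^-1 + \int[P]_w B w)
          - wage_share p q * \int[P]_w B w.
pose S := Num.max s0 (expR L).
have s0S : s0 <= S by rewrite le_max lexx.
have [s1 /[!in_itv]/= /andP[s01 s1S] s1min] :
    exists2 c, c \in `[s0, S] & forall t, t \in `[s0, S] -> f c <= f t.
  apply: EVT_min => //.
  exact/continuous_subspaceT/contract_disutility_continuous.
exists s0, s1; split=> // s s0s; have [sS|Ss] := leP s S.
  by apply: s1min; rewrite in_itv/= s0s.
apply: (@le_trans _ _ (f s0)); first by apply: s1min; rewrite in_itv/= lexx.
have Ls : expR L < s by rewrite (le_lt_trans _ Ss)// le_max lexx orbT.
have s_gt0 : 0 < s by rewrite (lt_trans _ Ls)// expR_gt0.
apply: le_trans (contract_disutility_coercive s_gt0 _); last first.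
  by rewrite -Gs0 agent_antitone.
rewrite -[leLHS]lnK ?posrE ?contract_disutility_gt0// ler_expR.
rewrite mulrC -ler_pdivrMr//.
have : L <= ln s by rewrite -[L]expRK ler_ln ?posrE ?expR_gt0// ltW.
rewrite /L; lra.
Qed.

End borch_wages.

(** * Expected exponential utility and existence of an optimal contract *)

Section exponential_expectation.
Context {R : realType} {d : measure_display} {T : measurableType d}.
Variable P : probability T R.

Lemma expectation_exp_utility (U : R -> R) (g k : R) (X : T -> R) :
  (forall x, U x = - expR (- g * x)) -> measurable_fun setT X ->
  ('E_P[fun w => U (k + X w)%R] =
   - ((expR (- g * k))%:E * \int[P]_w (expR (- g * X w))%:E))%E.
Proof.
move=> UE mX.
have meX : measurable_fun setT (fun w => (expR (- g * X w))%:E).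
  apply/measurable_EFinP; apply: measurableT_comp => //.
  exact: measurable_funM.
rewrite unlock -(ge0_integralZl_EFin P measurableT _ meX (expR_ge0 _)); last first.
  by move=> w _; rewrite lee_fin expR_ge0.
rewrite -integral_ge0N; last first.
  by move=> w _; rewrite -EFinM lee_fin mulr_ge0 ?expR_ge0.
by apply: eq_integral => w _; rewrite UE mulrDr expRD EFinN.
Qed.

End exponential_expectation.

Unset Implicit Arguments.

Theorem mainTheorem2 (R : realType) (d : measure_display)
    (Omega : measurableType d) (P : probability Omega R)
    (Omega_uncountable : ~ countable [set: Omega])
    (B : Omega -> R) (B_L2 : B \in Lfun P 2%:E)
    (x0 K : R) (K_gt0 : 0 < K)
    (m y : R) (m_ge0 : 0 <= m) (m_le_y : m <= y)
    (UP UA : R -> R) (gammaP gammaA : R)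
    (gammaP_gt0 : 0 < gammaP) (gammaA_gt0 : 0 < gammaA)
    (UP_exp : forall x : R, UP x = - expR (- gammaP * x))
    (UA_exp : forall x : R, UA x = - expR (- gammaA * x))
    (UP_fin : ('E_P[fun w => `|UP (outcome x0 B 0 w - y)|%R] < +oo)%E) :
  exists c : (Omega -> R) * R,
    admissible P K UA m y c /\
    principal_value P x0 B UP c =
      ereal_sup [set principal_value P x0 B UP c' | c' in admissible P K UA m y].
Proof.
have mfunL2 (X : Omega -> R) : X \in Lfun P 2%:E -> measurable_fun setT X.
  by rewrite inE => /andP[]; rewrite inE.
have mB := mfunL2 _ B_L2.
have iZ : P.-integrable setT (EFin \o (fun w => expR (- gammaP * B w))).
  have mU : measurable_fun setT (fun w => UP (outcome x0 B 0 w - y)).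
    rewrite (_ : (fun w => _) =
        (fun w => - expR (- gammaP * (x0 + 0 + B w - y)))); last first.
      by apply/funext => w; rewrite UP_exp.
    apply: measurableT_comp => //; apply: measurableT_comp => //.
    apply: measurable_funM => //; apply: measurable_funB => //.
    exact: measurable_funD.
  have iU : P.-integrable setT (EFin \o (fun w => UP (outcome x0 B 0 w - y))).
    apply/integrableP; split; first exact/measurable_EFinP.
    by move: UP_fin; rewrite unlock.
  have := integrableZl measurableT (- expR (gammaP * (x0 - y))) iU.
  congr (integrable _ _ _); apply/funext => w /=.
  rewrite UP_exp -EFinM mulrNN -expRD; congr (expR _)%:E.
  by rewrite /outcome; ring.
pose W s w := wage gammaP gammaA m s (B w).
have W2 s : W s \in Lfun P 2%:E by exact: wage_Lfun2.
pose G := agent_disutility P B gammaP gammaA m.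
pose H := principal_disutility P B gammaP gammaA m.
pose eff := effort P B gammaP gammaA m K y.
have agentE V a : V \in Lfun P 2%:E ->
    ('E_P[fun w => UA (V w - effort_cost K a)%R] =
     - ((expR (gammaA * effort_cost K a))%:E *
        \int[P]_w (expR (- gammaA * V w))%:E))%E.
  move=> V2; under eq_fun do rewrite addrC.
  by rewrite (expectation_exp_utility P _ UA_exp (mfunL2 _ V2)) mulrNN.
have principalE V a : V \in Lfun P 2%:E ->
    (principal_value P x0 B UP (V, a) =
     - ((expR (- gammaP * (x0 + a)))%:E *
        \int[P]_w (expR (- gammaP * (B w - V w)))%:E))%E.
  move=> V2; rewrite /principal_value /outcome/=.
  under eq_fun do rewrite -addrA.
  rewrite (expectation_exp_utility P _ UP_exp)//.
  by apply: measurable_funB => //; exact: mfunL2.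
have participationE V a : V \in Lfun P 2%:E ->
    ((UA y)%:E <= 'E_P[fun w => UA (V w - effort_cost K a)%R])%E =
    (\int[P]_w (expR (- gammaA * V w))%:E <=
     (expR (- gammaA * (y + effort_cost K a)))%:E)%E.
  move=> V2; rewrite agentE// UA_exp EFinN leeN2.
  rewrite -[RHS](@lee_pmul2l _ (expR (gammaA * effort_cost K a))%:E)//.
  - rewrite -[X in _ = (_ <= X)%E]EFinM -expRD; congr (_ <= (expR _)%:E)%E.
    by ring.
  - by rewrite lte_fin expR_gt0.
have [s0 [s1 [s01 Gs0 s1min]]] :=
  exists_best_wage gammaP_gt0 gammaA_gt0 B_L2 iZ K_gt0 m_le_y.
have Gs1 : G s1 <= expR (- gammaA * y).
  by rewrite -Gs0; exact: agent_antitone.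
have adm : admissible P K UA m y (W s1, eff s1).
  split=> //=; split; first by apply: aeW => w; exact: wage_ge.
  by rewrite participationE// agent_disutilityE// lee_fin -agent_binding.
exists (W s1, eff s1); split => //; apply/eqP; rewrite eq_le; apply/andP; split.
  by apply: ereal_sup_ubound; exists (W s1, eff s1).
apply: ge_ereal_sup => _ [[V a] [/= V2 [mV aV]] <-].
rewrite participationE// in aV.
(* A competitor (V, a) does no better than the sharing rule that gives the
   agent exactly the utility required under a, with effort |a|. *)
have [s s0s Gs] : exists2 s, s0 <= s &
    G s = expR (- gammaA * (y + effort_cost K a)).
  apply: agent_IVT => //; first exact: expR_gt0.
  rewrite Gs0 ler_expR !mulNr lerN2 ler_pM2l// lerDl.
  by rewrite /effort_cost divr_ge0// mulr_ge0 ?sqr_ge0// ltW.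
rewrite -Gs in aV.
have HV := wage_optimal gammaP_gt0 gammaA_gt0 B_L2 iZ (mfunL2 _ V2) mV aV.
rewrite !principalE// leeN2 principal_disutilityE//.
apply: (@le_trans _ _ ((expR (- gammaP * (x0 + a)))%:E * (H s)%:E)%E); last first.
  by apply: lee_wpmul2l => //; rewrite lee_fin expR_ge0.
rewrite -!EFinM lee_fin !mulrDr !expRD -!mulrA ler_pM2l ?expR_gt0//.
apply: (le_trans (s1min _ s0s)); rewrite /contract_disutility.
rewrite ler_wpM2r//.
  by apply: Rintegral_ge0 => w _; exact: expR_ge0.
rewrite ler_expR !mulNr lerN2 ler_pM2l// (effort_binding gammaA_gt0 K_gt0 Gs).
exact: ler_norm.
Qed.
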